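(* For any microCCS terms $M,N$ (possibly containing variables), $M$ and $N$ are extensionally equal if and only if $M=N$ is derivable in equational logic from $\mathcal D$.
   Context: Fix an infinite set of names. MicroCCS processes: $\eta ::= a\mid\overline a$, $P::=\mathbf 0\mid \eta.P\mid P|Q$, with transitions $\eta.P\xrightarrow{\eta}P$; if $P\xrightarrow{\eta}P'$, $Q\xrightarrow{\overline\eta}Q'$ then $P|Q\xrightarrow{\tau}P'|Q'$; if $P\xrightarrow{\mu}P'$ then $P|Q\xrightarrow{\mu}P'|Q$ and $Q|P\xrightarrow{\mu}Q|P'$. Strong bisimilarity $\sim$ is the union of all symmetric relations $\mathcal R$ such that $P\mathcal RQ$, $P\xrightarrow{\mu}P'$ imply $Q\xrightarrow{\mu}Q'$ with $P'\mathcal RQ'$. Terms with variables: $M::=\mathbf 0\mid\eta.M\mid M|M\mid X$. $M$ and $N$ are extensionally equal if for every ground instantiation $\rho$ (mapping all variables to variable-free terms) $M\rho\sim N\rho$. $\mathcal D$ consists of $X|Y=Y|X$, $X|(Y|Z)=(X|Y)|Z$, $X|\mathbf 0=X$, and for each $i\geq1$ and prefix $\eta$, $(D_i)\ \eta.(X|(\eta.X)^i)=(\eta.X)^{i+1}$, where $R^k$ is the $k$-fold parallel composition of $R$. Derivability is in equational logic. *)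

(* Defs.v *)
From Stdlib Require Import List Relation_Definitions.

Set Implicit Arguments.

Section MicroCCS.

Variable name : Type.

Inductive prefix : Type :=
| Inp (a : name)
| Out (a : name).

Definition co (eta : prefix) : prefix :=
  match eta with
  | Inp a => Out a
  | Out a => Inp a
  end.

Inductive action : Type :=
| Vis (eta : prefix)
| Tau.

Inductive proc : Type :=
| PNil
| PPre (eta : prefix) (P : proc)
| PPar (P Q : proc).

Inductive trans : proc -> action -> proc -> Prop :=
| trans_pre eta P : trans (PPre eta P) (Vis eta) P
| trans_com eta P P' Q Q' :
    trans P (Vis eta) P' -> trans Q (Vis (co eta)) Q' ->
    trans (PPar P Q) Tau (PPar P' Q')
| trans_parl mu P P' Q :
    trans P mu P' -> trans (PPar P Q) mu (PPar P' Q)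
| trans_parr mu P P' Q :
    trans P mu P' -> trans (PPar Q P) mu (PPar Q P').

Definition simulation (R : relation proc) : Prop :=
  forall P Q mu P', R P Q -> trans P mu P' ->
    exists Q', trans Q mu Q' /\ R P' Q'.

Definition bisimilar (P Q : proc) : Prop :=
  exists R : relation proc, symmetric proc R /\ simulation R /\ R P Q.

Inductive term : Type :=
| Nil
| Pre (eta : prefix) (M : term)
| Par (M N : term)
| Var (x : nat).

Fixpoint inst (rho : nat -> proc) (M : term) : proc :=
  match M with
  | Nil => PNil
  | Pre eta M => PPre eta (inst rho M)
  | Par M N => PPar (inst rho M) (inst rho N)
  | Var x => rho x
  end.

Definition ext_equal (M N : term) : Prop :=
  forall rho : nat -> proc, bisimilar (inst rho M) (inst rho N).

Fixpoint subst (sigma : nat -> term) (M : term) : term :=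
  match M with
  | Nil => Nil
  | Pre eta M => Pre eta (subst sigma M)
  | Par M N => Par (subst sigma M) (subst sigma N)
  | Var x => sigma x
  end.

Inductive derivable (E : relation term) : relation term :=
| der_ax M N : E M N -> derivable E M N
| der_refl M : derivable E M M
| der_sym M N : derivable E M N -> derivable E N M
| der_trans M N L : derivable E M N -> derivable E N L -> derivable E M L
| der_pre eta M N : derivable E M N -> derivable E (Pre eta M) (Pre eta N)
| der_par M M' N N' :
    derivable E M M' -> derivable E N N' ->
    derivable E (Par M N) (Par M' N')
| der_subst sigma M N :
    derivable E M N -> derivable E (subst sigma M) (subst sigma N).

(* [M | (M | ... | M)] with [k] copies of [M]; in particular [pow M 1] is [M]
   itself and not [M | 0]. *)
Fixpoint pow (M : term) (k : nat) : term :=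
  match k with
  | 0 => Nil
  | 1 => M
  | S k' => Par M (pow M k')
  end.

Inductive D : relation term :=
| D_comm : D (Par (Var 0) (Var 1)) (Par (Var 1) (Var 0))
| D_assoc :
    D (Par (Var 0) (Par (Var 1) (Var 2))) (Par (Par (Var 0) (Var 1)) (Var 2))
| D_nil : D (Par (Var 0) Nil) (Var 0)
| D_distr (i : nat) (eta : prefix) :
    1 <= i ->
    D (Pre eta (Par (Var 0) (pow (Pre eta (Var 0)) i)))
      (pow (Pre eta (Var 0)) (i + 1)).

End MicroCCS.

(* Main.v *)
Require Import Defs.
From Stdlib Require Import FinFun List Arith Lia Relation_Definitions.
From Stdlib Require Import Morphisms Classical ClassicalEpsilon.

(** The laws (D_i) rewrite every process into a parallel composition of prefixes
    [eta.A] with [A] not of the form [B | (eta.B)^i], hereditarily. Bisimilar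
    normal processes contain the same prefixes with the same multiplicities, by
    induction on size in the style of Milner and Moller's unique decomposition:
    if [p = eta.A] is a largest prefix occurring more often in [P] than in [Q],
    then [P] is a power of [p]; hence all derivatives of [Q] are equal, so [Q]
    is a power of some [eta.B], and comparing derivatives gives [P = p] and
    [A = B | (eta.B)^k], which normality forbids for [k >= 1] and which makes
    both sides equal for [k = 0].

    A variable [X] is eliminated by instantiating it with [a.0] for a fresh [a];
    reading every [a.M] back as [X | M] maps derivations to derivations. *)

(** * Strong bisimilarity: congruence, monoid laws, the laws (D_i), invariance of size *)

Section Bisimilarity.

Context {name : Type}.
Implicit Types (P Q R : proc name) (eta : prefix name) (mu : action name).

Lemma co_neq eta : co eta <> eta.
Proof. destruct eta; discriminate. Qed.

Lemma trans_nil_inv mu P : ~ trans (PNil name) mu P.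
Proof. intros H; inversion H. Qed.

Lemma trans_PPar_inv P Q mu R :
  trans (PPar P Q) mu R ->
  (exists eta P' Q', mu = Tau name /\ R = PPar P' Q' /\
     trans P (Vis eta) P' /\ trans Q (Vis (co eta)) Q') \/
  (exists P', R = PPar P' Q /\ trans P mu P') \/
  (exists Q', R = PPar P Q' /\ trans Q mu Q').
Proof. intros H; inversion H; subst; eauto 10. Qed.

Ltac trans_PPar_cases :=
  repeat match goal with
  | H : trans (PPar _ _) _ _ |- _ => apply trans_PPar_inv in H
  | H : _ \/ _ |- _ => destruct H
  | H : exists _, _ |- _ => destruct H
  | H : _ /\ _ |- _ => destruct H
  end; subst.

(** The symmetric closure of [S] is a bisimulation, so the natural one-sided witnesses, as for
    associativity, suffice. *)
Lemma bisimilar_intro (S : relation (proc name)) P Q :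
  simulation S -> simulation (fun X Y => S Y X) -> S P Q -> bisimilar P Q.
Proof.
  intros HS HS' HPQ; exists (fun X Y => S X Y \/ S Y X); split; [|split].
  - intros X Y; tauto.
  - intros X Y mu X' [H|H] Ht.
    + destruct (HS _ _ _ _ H Ht) as [Y' []]; eauto.
    + destruct (HS' _ _ _ _ H Ht) as [Y' []]; eauto.
  - auto.
Qed.

Lemma bisimilar_trans_l P Q mu P' :
  bisimilar P Q -> trans P mu P' -> exists Q', trans Q mu Q' /\ bisimilar P' Q'.
Proof.
  intros (S & Hsym & Hsim & HPQ) Ht.
  destruct (Hsim _ _ _ _ HPQ Ht) as (Q' & HQ & HS).
  exists Q'; split; [assumption|exists S; auto].
Qed.

#[global] Instance bisimilar_sym : Symmetric (@bisimilar name).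
Proof. intros P Q (S & Hsym & Hsim & HPQ); exists S; auto. Qed.

#[global] Instance bisimilar_equiv : Equivalence (@bisimilar name).
Proof.
  split.
  - intros P; apply (bisimilar_intro eq); auto; intros X Y mu X' -> Ht; eauto.
  - exact bisimilar_sym.
  - intros P Q R HPQ HQR.
    apply (bisimilar_intro (fun X Z => exists Y, bisimilar X Y /\ bisimilar Y Z)).
    + intros X Z mu X' (Y & H1 & H2) Ht.
      destruct (bisimilar_trans_l _ _ _ _ H1 Ht) as (Y' & Ht' & H1').
      destruct (bisimilar_trans_l _ _ _ _ H2 Ht') as (Z' & Ht'' & H2'); eauto.
    + intros Z X mu Z' (Y & H1 & H2) Ht; symmetry in H1, H2.
      destruct (bisimilar_trans_l _ _ _ _ H2 Ht) as (Y' & Ht' & H1').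
      destruct (bisimilar_trans_l _ _ _ _ H1 Ht') as (X' & Ht'' & H2').
      exists X'; split; auto; exists Y'; split; symmetry; auto.
    + eauto.
Qed.

(** Bisimilarity extended by the single pair [(P, Q)] is still a bisimulation, so only first
    transitions need inspection. *)
Lemma bisimilar_fold P Q :
  (forall mu P', trans P mu P' -> exists Q', trans Q mu Q' /\ bisimilar P' Q') ->
  (forall mu Q', trans Q mu Q' -> exists P', trans P mu P' /\ bisimilar P' Q') ->
  bisimilar P Q.
Proof.
  intros H1 H2.
  apply (bisimilar_intro (fun X Y => bisimilar X Y \/ (X = P /\ Y = Q))); auto.
  - intros X Y mu X' [H|[-> ->]] Ht.
    + destruct (bisimilar_trans_l _ _ _ _ H Ht) as (Y' & ? & ?); eauto.
    + destruct (H1 _ _ Ht) as (Y' & ? & ?); eauto.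
  - intros Y X mu Y' [H|[-> ->]] Ht.
    + symmetry in H; destruct (bisimilar_trans_l _ _ _ _ H Ht) as (X' & ? & ?).
      exists X'; split; auto; left; symmetry; auto.
    + destruct (H2 _ _ Ht) as (X' & ? & ?); exists X'; split; auto; left; auto.
Qed.

#[global] Instance PPre_bisimilar eta :
  Proper (@bisimilar name ==> @bisimilar name) (PPre eta).
Proof.
  intros P Q H; apply bisimilar_fold; intros mu R Ht; inversion Ht; subst;
    eexists; split; eauto; constructor.
Qed.

#[global] Instance PPar_bisimilar :
  Proper (@bisimilar name ==> @bisimilar name ==> @bisimilar name) (@PPar name).
Proof.
  set (S := fun X Y => exists P P' Q Q',
    X = PPar P Q /\ Y = PPar P' Q' /\ bisimilar P P' /\ bisimilar Q Q').
  assert (HS : simulation S).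
  { intros X Y mu X' (P & P' & Q & Q' & -> & -> & HP & HQ) Ht.
    destruct (trans_PPar_inv _ _ _ _ Ht)
      as [(eta & P1 & Q1 & -> & -> & H1 & H2)|[(P1 & -> & H1)|(Q1 & -> & H1)]].
    - destruct (bisimilar_trans_l _ _ _ _ HP H1) as (P1' & ? & ?).
      destruct (bisimilar_trans_l _ _ _ _ HQ H2) as (Q1' & ? & ?).
      exists (PPar P1' Q1'); split; [econstructor; eauto|].
      unfold S; eauto 10.
    - destruct (bisimilar_trans_l _ _ _ _ HP H1) as (P1' & ? & ?).
      exists (PPar P1' Q'); split; [constructor; auto|unfold S; eauto 10].
    - destruct (bisimilar_trans_l _ _ _ _ HQ H1) as (Q1' & ? & ?).
      exists (PPar P' Q1'); split; [constructor; auto|unfold S; eauto 10]. }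
  intros P P' HP Q Q' HQ; exists S; split; [|split]; auto.
  - intros X Y (P1 & P1' & Q1 & Q1' & -> & -> & H1 & H2).
    exists P1', P1, Q1', Q1; repeat split; auto; symmetry; auto.
  - exists P, P', Q, Q'; auto.
Qed.

Lemma PPar_comm P Q : bisimilar (PPar P Q) (PPar Q P).
Proof.
  exists (fun X Y => exists P Q, X = PPar P Q /\ Y = PPar Q P); split; [|split].
  - intros X Y (A & B & -> & ->); eauto.
  - intros X Y mu X' (A & B & -> & ->) Ht; inversion Ht; subst;
      (eexists; split; [|do 2 eexists; split; reflexivity]);
      try (constructor; assumption).
    (* Swapping the partners exchanges [eta] and [co eta], and [co] is an involution. *)
    apply trans_com with (co eta); auto; destruct eta; assumption.
  - eauto.
Qed.

Lemma PPar_assoc P Q R : bisimilar (PPar P (PPar Q R)) (PPar (PPar P Q) R).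
Proof.
  apply (bisimilar_intro (fun X Y => exists P Q R,
    X = PPar P (PPar Q R) /\ Y = PPar (PPar P Q) R)); [| |eauto].
  - intros X Y mu X' (A & B & C & -> & ->) Ht.
    trans_PPar_cases; try discriminate;
      (eexists; split; [|do 3 eexists; split; reflexivity]); eauto using trans.
  - intros Y X mu Y' (A & B & C & -> & ->) Ht.
    trans_PPar_cases; try discriminate;
      (eexists; split; [|do 3 eexists; split; reflexivity]); eauto using trans.
Qed.

Lemma PPar_nil P : bisimilar (PPar P (PNil name)) P.
Proof.
  apply (bisimilar_intro (fun X Y => X = PPar Y (PNil name))); auto.
  - intros X Y mu X' -> Ht; inversion Ht; subst;
      try (exfalso; eapply trans_nil_inv; eassumption); eauto.
  - intros Y X mu Y' -> Ht; eexists; split; [|reflexivity]; constructor; auto.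
Qed.

(** The case split of [pow] is repeated so that [inst] and [emb] commute with powers
    syntactically. *)
Fixpoint ppow P (k : nat) : proc name :=
  match k with
  | 0 => PNil name
  | 1 => P
  | S k' => PPar P (ppow P k')
  end.

Lemma bisimilar_ppow_S P k : bisimilar (ppow P (S k)) (PPar P (ppow P k)).
Proof. destruct k; [symmetry; apply PPar_nil|reflexivity]. Qed.

(** Copies of one prefix cannot communicate, as [co eta] differs from [eta], and whichever copy
    fires leaves the same process up to commutativity and associativity. *)
Lemma trans_ppow_PPre eta P k mu Q :
  trans (ppow (PPre eta P) (S k)) mu Q ->
  mu = Vis eta /\ bisimilar Q (PPar P (ppow (PPre eta P) k)).
Proof.
  revert mu Q; induction k as [|k IH]; intros mu Q Ht.
  - inversion Ht; subst; split; auto; symmetry; apply PPar_nil.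
  - change (ppow (PPre eta P) (S (S k)))
      with (PPar (PPre eta P) (ppow (PPre eta P) (S k))) in Ht.
    destruct (trans_PPar_inv _ _ _ _ Ht)
      as [(zeta & P1 & Q1 & -> & -> & H1 & H2)|[(P1 & -> & H1)|(Q1 & -> & H1)]].
    + inversion H1; subst; destruct (IH _ _ H2) as [E _].
      exfalso; apply (co_neq zeta); congruence.
    + inversion H1; subst; split; reflexivity.
    + destruct (IH _ _ H1) as [-> E]; split; auto.
      rewrite E, bisimilar_ppow_S, !PPar_assoc, (PPar_comm (PPre eta P)).
      reflexivity.
Qed.

Lemma PPre_distr eta P i :
  bisimilar (PPre eta (PPar P (ppow (PPre eta P) i))) (ppow (PPre eta P) (S i)).
Proof.
  apply bisimilar_fold; intros mu R Ht.
  - inversion Ht; subst; destruct i.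
    + exists P; split; [constructor|apply PPar_nil].
    + eexists; split; [|reflexivity]; apply trans_parl, trans_pre.
  - destruct (trans_ppow_PPre _ _ _ _ _ Ht) as [-> E].
    eexists; split; [constructor|symmetry; exact E].
Qed.

Fixpoint size P : nat :=
  match P with
  | PNil _ => 0
  | PPre _ P => S (size P)
  | PPar P Q => size P + size Q
  end.

Lemma size_trans P eta P' : trans P (Vis eta) P' -> size P = S (size P').
Proof.
  remember (Vis eta) as mu; intros Ht; induction Ht; simpl; try discriminate;
    try rewrite IHHt by assumption; lia.
Qed.

Lemma size_pos_trans P : 0 < size P -> exists eta P', trans P (Vis eta) P'.
Proof.
  induction P as [|eta P _|P IHP Q IHQ]; simpl; intros Hs.
  - lia.
  - eauto using trans.
  - destruct (size P).
    + destruct IHQ as (eta & Q' & ?); eauto using trans.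
    + destruct IHP as (eta & P' & ?); [lia|eauto using trans].
Qed.

(** A visible action consumes exactly one prefix, and a process of positive size always has one; so
    the size is the length of any maximal run of visible actions. *)
Lemma bisimilar_size P Q : bisimilar P Q -> size P = size Q.
Proof.
  remember (size P) as n eqn:Hn; revert P Q Hn.
  induction n as [|n IH]; intros P Q Hn H.
  - destruct (Nat.eq_0_gt_0_cases (size Q)) as [|HQ]; auto.
    destruct (size_pos_trans _ HQ) as (eta & Q' & Ht); symmetry in H.
    destruct (bisimilar_trans_l _ _ _ _ H Ht) as (P' & Ht' & _).
    apply size_trans in Ht'; lia.
  - destruct (size_pos_trans P) as (eta & P' & Ht); [lia|].
    destruct (bisimilar_trans_l _ _ _ _ H Ht) as (Q' & Ht' & H').
    apply size_trans in Ht, Ht'; rewrite Ht'; f_equal; apply (IH P'); auto; lia.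
Qed.

End Bisimilarity.

(** * Equational logic over [D] and its soundness *)

Section Derivability.

Context {name : Type}.
Implicit Types (M N : term name) (P Q R : proc name) (eta : prefix name).

Notation "M == N" := (derivable (@D name) M N) (at level 70).

#[global] Instance derivable_equiv (E : relation (term name)) :
  Equivalence (derivable E).
Proof.
  split; [intros ?; apply der_refl|intros ? ?; apply der_sym
         |intros ? ? ?; apply der_trans].
Qed.

#[global] Instance Par_derivable (E : relation (term name)) :
  Proper (derivable E ==> derivable E ==> derivable E) (@Par name).
Proof. intros ? ? ? ? ? ?; apply der_par; auto. Qed.

#[global] Instance Pre_derivable (E : relation (term name)) eta :
  Proper (derivable E ==> derivable E) (Pre eta).
Proof. intros ? ? ?; apply der_pre; auto. Qed.

Definition sub3 M N L (x : nat) : term name :=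
  match x with 0 => M | 1 => N | _ => L end.

Lemma Par_comm M N : Par M N == Par N M.
Proof. exact (der_subst (sub3 M N N) (der_ax _ _ _ (D_comm name))). Qed.

Lemma Par_assoc M N L : Par M (Par N L) == Par (Par M N) L.
Proof. exact (der_subst (sub3 M N L) (der_ax _ _ _ (D_assoc name))). Qed.

Lemma Par_nil M : Par M (Nil name) == M.
Proof. exact (der_subst (sub3 M M M) (der_ax _ _ _ (D_nil name))). Qed.

Lemma subst_pow sigma M k : subst sigma (pow M k) = pow (subst sigma M) k.
Proof.
  induction k as [|[|k] IH]; auto; simpl in *; rewrite IH; reflexivity.
Qed.

Lemma inst_pow rho M k : inst rho (pow M k) = ppow (inst rho M) k.
Proof.
  induction k as [|[|k] IH]; auto; simpl in *; rewrite IH; reflexivity.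
Qed.

Lemma pow_S M k : pow M (S k) == Par M (pow M k).
Proof. destruct k; [symmetry; apply Par_nil|reflexivity]. Qed.

Lemma Pre_distr eta M i :
  1 <= i -> Pre eta (Par M (pow (Pre eta M) i)) == pow (Pre eta M) (S i).
Proof.
  intros Hi; pose proof (der_subst (sub3 M M M) (der_ax _ _ _ (D_distr eta Hi))) as H.
  rewrite Nat.add_1_r in H; cbn [subst] in H; rewrite !subst_pow in H; exact H.
Qed.

Lemma inst_subst rho sigma M :
  inst rho (subst sigma M) = inst (fun x => inst rho (sigma x)) M.
Proof. induction M; simpl; congruence. Qed.

Lemma subst_subst tau sigma M :
  subst tau (subst sigma M) = subst (fun x => subst tau (sigma x)) M.
Proof. induction M; simpl; congruence. Qed.

Lemma subst_Var M : subst (@Var name) M = M.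
Proof. induction M; simpl; congruence. Qed.

(** The claim ranges over all [rho], so a substitution step is absorbed into the instantiation. *)
Lemma derivable_sound M N : M == N -> ext_equal M N.
Proof.
  induction 1 as [M N H| | |M N L _ IH1 _ IH2|eta M N _ IH|M M' N N' _ IH1 _ IH2
                 |sigma M N _ IH]; intros rho; simpl.
  - destruct H; simpl; auto using PPar_comm, PPar_assoc, PPar_nil.
    rewrite !inst_pow, Nat.add_1_r; apply PPre_distr.
  - reflexivity.
  - symmetry; auto.
  - rewrite (IH1 rho); auto.
  - rewrite (IH rho); reflexivity.
  - rewrite (IH1 rho), (IH2 rho); reflexivity.
  - rewrite !inst_subst; apply IH.
Qed.

Fixpoint emb P : term name :=
  match P with
  | PNil _ => Nil name
  | PPre eta P => Pre eta (emb P)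
  | PPar P Q => Par (emb P) (emb Q)
  end.

Lemma inst_emb rho P : inst rho (emb P) = P.
Proof. induction P; simpl; congruence. Qed.

Lemma emb_ppow P k : emb (ppow P k) = pow (emb P) k.
Proof.
  induction k as [|[|k] IH]; auto; simpl in *; rewrite IH; reflexivity.
Qed.

End Derivability.

(** * Provable equality of closed processes *)

Definition eqD {name : Type} (P Q : proc name) : Prop :=
  derivable (@D name) (emb P) (emb Q).

Section NormalForms.

Context {name : Type}.
Implicit Types (P Q R A B C : proc name) (eta : prefix name).

Notation "P == Q" := (eqD P Q) (at level 70).

#[global] Instance eqD_equiv : Equivalence (@eqD name).
Proof.
  unfold eqD; split; [intros P|intros P Q H|intros P Q R H1 H2].
  - reflexivity.
  - symmetry; exact H.
  - rewrite H1; exact H2.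
Qed.

#[global] Instance PPar_eqD :
  Proper (@eqD name ==> @eqD name ==> @eqD name) (@PPar name).
Proof. intros ? ? ? ? ? ?; apply der_par; auto. Qed.

#[global] Instance PPre_eqD eta : Proper (@eqD name ==> @eqD name) (PPre eta).
Proof. intros ? ? ?; apply der_pre; auto. Qed.

Lemma eqD_comm P Q : PPar P Q == PPar Q P.
Proof. apply Par_comm. Qed.

Lemma eqD_assoc P Q R : PPar P (PPar Q R) == PPar (PPar P Q) R.
Proof. apply Par_assoc. Qed.

Lemma eqD_nil P : PPar P (PNil name) == P.
Proof. apply Par_nil. Qed.

Lemma eqD_distr eta P i :
  1 <= i -> PPre eta (PPar P (ppow (PPre eta P) i)) == ppow (PPre eta P) (S i).
Proof.
  intros Hi; unfold eqD; cbn [emb]; rewrite !emb_ppow.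
  cbn [emb]; apply Pre_distr; auto.
Qed.

Lemma eqD_sound P Q : P == Q -> bisimilar P Q.
Proof.
  intros H; apply derivable_sound in H; specialize (H (fun _ => PNil name)).
  rewrite !inst_emb in H; exact H.
Qed.

Lemma eqD_size P Q : P == Q -> size P = size Q.
Proof. intros H; apply bisimilar_size, eqD_sound, H. Qed.

(** The bodies are related only by bisimilarity, since the argument goes through soundness; below,
    an induction hypothesis turns this into equal multiplicities. *)
Lemma eqD_PPre_inv eta zeta A B :
  PPre eta A == PPre zeta B -> eta = zeta /\ bisimilar A B.
Proof.
  intros H; apply eqD_sound in H.
  destruct (bisimilar_trans_l _ _ _ _ H (trans_pre eta A)) as (Q & Ht & HQ).
  inversion Ht; subst; auto.
Qed.

Definition ind (X : Prop) : nat :=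
  if excluded_middle_informative X then 1 else 0.

Lemma ind_true (X : Prop) : X -> ind X = 1.
Proof. unfold ind; destruct excluded_middle_informative; tauto. Qed.

Lemma ind_false (X : Prop) : ~ X -> ind X = 0.
Proof. unfold ind; destruct excluded_middle_informative; tauto. Qed.

Lemma ind_pos (X : Prop) : 0 < ind X -> X.
Proof. unfold ind; destruct excluded_middle_informative; [auto|lia]. Qed.

Lemma ind_iff (X Y : Prop) : (X <-> Y) -> ind X = ind Y.
Proof. unfold ind; do 2 destruct excluded_middle_informative; tauto. Qed.

(** * Multisets of components, normal forms and derivatives *)

Inductive comp : proc name -> prefix name -> proc name -> Prop :=
| comp_pre eta A : comp (PPre eta A) eta A
| comp_parl P Q eta A : comp P eta A -> comp (PPar P Q) eta A
| comp_parr P Q eta A : comp Q eta A -> comp (PPar P Q) eta A.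

(** Multisets are handled as multiplicity functions that identify provably equal prefixes, which
    reduces multiset equations to linear arithmetic at each [r]. *)
Fixpoint cnt (p P : proc name) : nat :=
  match P with
  | PNil _ => 0
  | PPre eta A => ind (PPre eta A == p)
  | PPar P Q => cnt p P + cnt p Q
  end.

Lemma cnt_size p P : 0 < cnt p P -> size p <= size P.
Proof.
  induction P; simpl; intros H.
  - lia.
  - apply ind_pos, eqD_size in H; simpl in H; lia.
  - assert (0 < cnt p P1 \/ 0 < cnt p P2) as [] by lia;
      [apply IHP1 in H0|apply IHP2 in H0]; lia.
Qed.

Lemma cnt_small p P : size P < size p -> cnt p P = 0.
Proof.
  intros H; destruct (Nat.eq_0_gt_0_cases (cnt p P)) as [|Hp]; auto.
  apply cnt_size in Hp; lia.
Qed.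

Lemma cnt_le_size p P : cnt p P <= size P.
Proof.
  induction P; simpl; try lia.
  unfold ind; destruct excluded_middle_informative; lia.
Qed.

Lemma comp_size P eta A : comp P eta A -> size A < size P.
Proof. induction 1; simpl; lia. Qed.

Lemma cnt_pos_comp p P :
  0 < cnt p P -> exists eta A, comp P eta A /\ PPre eta A == p.
Proof.
  induction P; simpl; intros H.
  - lia.
  - apply ind_pos in H; eauto using comp.
  - assert (0 < cnt p P1 \/ 0 < cnt p P2) as [] by lia;
      [apply IHP1 in H0|apply IHP2 in H0];
      destruct H0 as (eta & A & ? & ?); eauto using comp.
Qed.

Lemma comp_cnt_pos P eta A : comp P eta A -> 0 < cnt (PPre eta A) P.
Proof.
  induction 1; simpl; [|lia|lia].
  rewrite ind_true by reflexivity; auto.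
Qed.

Lemma comp_eqD P eta A :
  comp P eta A -> exists P', P == PPar (PPre eta A) P' /\
    forall r, cnt r P = cnt r (PPre eta A) + cnt r P'.
Proof.
  induction 1 as [eta A|P Q eta A _ (P' & H & Hc)|P Q eta A _ (P' & H & Hc)].
  - exists (PNil name); split; [symmetry; apply eqD_nil|intros r; simpl; lia].
  - exists (PPar P' Q); split.
    + rewrite H, eqD_assoc; reflexivity.
    + intros r; specialize (Hc r); simpl in *; lia.
  - exists (PPar P P'); split.
    + rewrite H, !eqD_assoc, (eqD_comm P); reflexivity.
    + intros r; specialize (Hc r); simpl in *; lia.
Qed.

Lemma cnt_zero_eqD P : (forall r, cnt r P = 0) -> P == PNil name.
Proof.
  induction P as [|eta A _|P IHP Q IHQ]; intros H.
  - reflexivity.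
  - specialize (H (PPre eta A)); simpl in H.
    rewrite ind_true in H; [discriminate|reflexivity].
  - rewrite IHP, IHQ by (intros r; specialize (H r); simpl in H; lia).
    apply eqD_nil.
Qed.

(** Multiset difference: the prefixes of [P] are removed from [Q] one by one. In the parallel case
    the part still to be removed is counted into [c]. *)
Lemma cnt_split P Q c :
  (forall r, cnt r Q = cnt r P + c r) ->
  exists Q', Q == PPar P Q' /\ forall r, cnt r Q' = c r.
Proof.
  revert Q c; induction P as [|eta A _|P1 IH1 P2 IH2]; intros Q c H.
  - exists Q; split; [rewrite eqD_comm; symmetry; apply eqD_nil|exact H].
  - destruct (cnt_pos_comp (PPre eta A) Q) as (zeta & B & HB & E).
    { rewrite H; simpl; rewrite ind_true by reflexivity; lia. }
    destruct (comp_eqD _ _ _ HB) as (Q' & HQ & Hc).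
    exists Q'; split; [rewrite HQ, E; reflexivity|].
    intros r; specialize (H r); specialize (Hc r); simpl in *.
    assert (ind (PPre zeta B == r) = ind (PPre eta A == r)); [|lia].
    apply ind_iff; rewrite E; reflexivity.
  - destruct (IH1 Q (fun r => cnt r P2 + c r)) as (Q1 & E1 & H1).
    { intros r; rewrite H; simpl; lia. }
    destruct (IH2 Q1 c H1) as (Q2 & E2 & H2).
    exists Q2; split; auto; rewrite E1, E2; apply eqD_assoc.
Qed.

Lemma cnt_inj P Q : (forall r, cnt r P = cnt r Q) -> P == Q.
Proof.
  intros H; destruct (cnt_split P Q (fun _ => 0)) as (R & E & HR).
  { intros r; rewrite H; lia. }
  rewrite E, (cnt_zero_eqD R HR); symmetry; apply eqD_nil.
Qed.

Lemma cnt_ppow r P k : cnt r (ppow P k) = k * cnt r P.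
Proof.
  induction k as [|[|k] IH]; simpl in *; [auto|lia|rewrite IH; lia].
Qed.

Lemma cnt_all_comps p P :
  (forall eta A, comp P eta A -> PPre eta A == p) ->
  exists k, forall r, cnt r P = k * ind (p == r).
Proof.
  induction P as [|eta A _|P IHP Q IHQ]; intros H.
  - exists 0; auto.
  - exists 1; intros r; simpl; rewrite Nat.add_0_r; apply ind_iff.
    rewrite (H _ _ (comp_pre eta A)); reflexivity.
  - destruct IHP as [k Hk]; [eauto using comp|].
    destruct IHQ as [l Hl]; [eauto using comp|].
    exists (k + l); intros r; simpl; rewrite Hk, Hl; lia.
Qed.

(* Primality up to [eqD]: prefixes in normal form do not split by (D_i). *)
Fixpoint normal P : Prop :=
  match P with
  | PNil _ => True
  | PPre eta A =>
      normal A /\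
      ~ exists B i, 1 <= i /\ A == PPar B (ppow (PPre eta B) i)
  | PPar P Q => normal P /\ normal Q
  end.

Lemma normal_comp P eta A : normal P -> comp P eta A -> normal (PPre eta A).
Proof. intros HP HA; induction HA; auto; apply IHHA, HP. Qed.

Lemma normal_ppow P k : normal P -> normal (ppow P k).
Proof.
  intros HP; induction k as [|[|k] IH]; auto; simpl in *; auto.
Qed.

(** When (D_i) applies, the process is a power of [PPre eta B], which is smaller but need not be
    normal: this uses the outer induction on size. The inner structural induction handles parallel
    compositions, where a factor may have the size of the whole. *)
Lemma normal_form P : exists P', P == P' /\ normal P'.
Proof.
  remember (size P) as n eqn:Hn; assert (Hs : size P <= n) by lia; clear Hn.
  revert P Hs; induction n as [n IHn] using lt_wf_ind.
  induction P as [|eta A IHA|P IHP Q IHQ]; simpl; intros Hs.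
  - exists (PNil name); split; [reflexivity|exact I].
  - destruct IHA as (A' & E & HA); [lia|].
    destruct (classic (exists B i, 1 <= i /\ A' == PPar B (ppow (PPre eta B) i)))
      as [(B & i & Hi & EB)|Hp].
    + rewrite EB in E; assert (Hsz := eqD_size _ _ E).
      destruct i as [|i]; [lia|]; simpl in Hsz.
      destruct (IHn (size (PPre eta B))) with (P := PPre eta B) as (R & ER & HR).
      { destruct i; simpl in *; lia. }
      { auto. }
      exists (ppow R (S (S i))); split; [|apply normal_ppow, HR].
      rewrite E, eqD_distr by lia; generalize (S (S i)); intros k.
      induction k as [|[|k] IH]; auto; [reflexivity|].
      cbn [ppow] in *; rewrite IH, ER; reflexivity.
    + exists (PPre eta A'); split; [rewrite E; reflexivity|split; auto].
  - destruct IHP as (P' & EP & HP); [lia|].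
    destruct IHQ as (Q' & EQ & HQ); [lia|].
    exists (PPar P' Q'); split; [rewrite EP, EQ; reflexivity|split; auto].
Qed.

(** As multisets, [P' = P - eta.A + A], written without truncated subtraction. *)
Definition derivative eta P A P' : Prop :=
  comp P eta A /\
  (forall r, cnt r P' + cnt r (PPre eta A) = cnt r P + cnt r A) /\
  (normal P -> normal P').

Lemma trans_derivative P eta P' :
  trans P (Vis eta) P' -> exists A, derivative eta P A P'.
Proof.
  unfold derivative; remember (Vis eta) as mu; intros Ht.
  induction Ht as [zeta A| |mu P P' Q _ IH|mu P P' Q _ IH]; try discriminate.
  - injection Heqmu as ->; exists A; split; [constructor|]; split.
    + intros r; lia.
    + intros []; auto.
  - destruct (IH Heqmu) as (A & HA & Hc & Hn).
    exists A; split; [constructor; auto|]; split.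
    + intros r; specialize (Hc r); simpl in *; lia.
    + intros []; split; auto.
  - destruct (IH Heqmu) as (A & HA & Hc & Hn).
    exists A; split; [constructor; auto|]; split.
    + intros r; specialize (Hc r); simpl in *; lia.
    + intros []; split; auto.
Qed.

Lemma comp_trans P eta A :
  comp P eta A -> exists P', trans P (Vis eta) P' /\ derivative eta P A P'.
Proof.
  unfold derivative.
  induction 1 as [eta A|P Q eta A HA (P' & Ht & _ & Hc & Hn)
                 |P Q eta A HA (P' & Ht & _ & Hc & Hn)].
  - exists A; split; [constructor|]; split; [constructor|]; split.
    + intros r; lia.
    + intros []; auto.
  - exists (PPar P' Q); split; [constructor; auto|].
    split; [constructor; auto|]; split.
    + intros r; specialize (Hc r); simpl in *; lia.
    + intros []; split; auto.
  - exists (PPar P P'); split; [constructor; auto|].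
    split; [constructor; auto|]; split.
    + intros r; specialize (Hc r); simpl in *; lia.
    + intros []; split; auto.
Qed.

(** * Unique decomposition of normal processes *)

Lemma exists_max (X : nat -> Prop) b :
  (exists n, X n) -> (forall n, X n -> n <= b) ->
  exists n, X n /\ forall k, X k -> k <= n.
Proof.
  revert X; induction b as [|b IH]; intros X [n Hn] Hb.
  - exists n; split; auto; intros k Hk; apply Hb in Hk; lia.
  - destruct (classic (X (S b))) as [H|H]; [eauto|].
    apply IH; [eauto|]; intros k Hk; specialize (Hb _ Hk).
    destruct (Nat.eq_dec k (S b)); [congruence|lia].
Qed.

Section UniqueDecomposition.

Variables M N : proc name.
Hypothesis IH : forall P Q, size P < size M -> normal P -> normal Q ->
  bisimilar P Q -> forall r, cnt r P = cnt r Q.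
Hypotheses (HM : normal M) (HN : normal N) (HMN : bisimilar M N).

(** The residual of [M] is smaller than [M], so [IH] identifies the residuals [M - eta.A + A] and
    [N - eta.B + B] as multisets. *)
Lemma match_comp eta A :
  comp M eta A -> exists B, comp N eta B /\ forall r,
    cnt r M + cnt r A + cnt r (PPre eta B) =
    cnt r N + cnt r B + cnt r (PPre eta A).
Proof.
  intros HA; destruct (comp_trans _ _ _ HA) as (M' & Ht & _ & Hc & Hn).
  destruct (bisimilar_trans_l _ _ _ _ HMN Ht) as (N' & Ht' & HMN').
  destruct (trans_derivative _ _ _ Ht') as (B & HB & Hc' & Hn').
  exists B; split; auto; intros r; specialize (Hc r); specialize (Hc' r).
  apply size_trans in Ht; rewrite (IH M' N') in Hc; auto; lia.
Qed.

Variable p : proc name.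
Hypothesis Hp : cnt p N < cnt p M.
Hypothesis Hmax : forall q, cnt q M <> cnt q N -> size q <= size p.

(* Otherwise, consume the component other than [p] that releases most copies
   of [p]: the answer of [N] has to release even more of them, hence consumes
   a component larger than [p], and [M] has that component too. *)
Lemma larger_all_comps eta A : comp M eta A -> PPre eta A == p.
Proof.
  intros HA; apply NNPP; intros Hne.
  destruct (exists_max (fun c => exists zeta C, comp M zeta C /\
    ~ PPre zeta C == p /\ cnt p C = c) (size M))
    as (c & (zeta & C & HC & Hpc & <-) & Hc).
  { eauto 6. }
  { intros c (zeta & C & HC & _ & <-); apply comp_size in HC.
    pose proof (cnt_le_size p C); lia. }
  destruct (match_comp _ _ HC) as (B & HB & E); specialize (E p); simpl in E.
  rewrite (ind_false (PPre zeta C == p)) in E by assumption.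
  (* By [E] and [Hp], [cnt p B] exceeds [cnt p C]; in particular [B] contains a copy of [p]. *)
  assert (Hs : size p < size (PPre zeta B)) by (simpl; pose proof (cnt_size p B); lia).
  assert (HBM : 0 < cnt (PPre zeta B) M).
  { replace (cnt (PPre zeta B) M) with (cnt (PPre zeta B) N).
    - apply comp_cnt_pos; assumption.
    - apply NNPP; intros Hd; specialize (Hmax (PPre zeta B)).
      apply not_eq_sym in Hd; specialize (Hmax Hd); lia. }
  destruct (cnt_pos_comp _ _ HBM) as (zeta' & B' & HB' & E').
  assert (cnt p B' <= cnt p C).
  { apply Hc; exists zeta', B'; repeat split; auto.
    intros E''; apply eqD_size in E', E''; lia. }
  (* [B'] and [B] are bisimilar and smaller than [M], so [IH] equates their counts, against the
     maximality of [cnt p C]. *)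
  assert (cnt p B' = cnt p B); [|lia].
  destruct (eqD_PPre_inv _ _ _ _ E') as [-> HBB]; apply IH; auto.
  - apply comp_size in HB'; assumption.
  - apply (normal_comp _ _ _ HM HB').
  - apply (normal_comp _ _ _ HN HB).
Qed.

End UniqueDecomposition.

Lemma normal_unequal_absurd M N p :
  (forall P Q, size P < size M -> normal P -> normal Q ->
     bisimilar P Q -> forall r, cnt r P = cnt r Q) ->
  normal M -> normal N -> bisimilar M N -> cnt p N < cnt p M ->
  (forall q, cnt q M <> cnt q N -> size q <= size p) -> False.
Proof.
  intros IH HM HN HMN Hp Hmax.
  pose proof (larger_all_comps M N IH HM HN HMN p Hp Hmax) as Hall.
  destruct (cnt_pos_comp p M) as (eta & A & HA & EA); [lia|].
  assert (HNM : bisimilar N M) by (symmetry; assumption).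
  assert (IH' : forall P Q, size P < size N -> normal P -> normal Q ->
    bisimilar P Q -> forall r, cnt r P = cnt r Q).
  { rewrite (bisimilar_size _ _ HNM); assumption. }
  (* Whatever [N] consumes, [M] must answer with a copy of [p], so every residual of [N] is the
     multiset [M - p + A]. *)
  assert (Hstep : forall zeta B, comp N zeta B -> zeta = eta /\ forall r,
    cnt r N + cnt r B + ind (p == r) =
    cnt r M + cnt r A + cnt r (PPre zeta B)).
  { intros zeta B HB.
    destruct (match_comp N M IH' HN HM HNM _ _ HB) as (C & HC & E).
    pose proof (Hall _ _ HC) as EC.
    destruct (eqD_PPre_inv zeta eta C A) as [-> HCA].
    { rewrite EC, EA; reflexivity. }
    split; auto; intros r; specialize (E r); simpl in *.
    rewrite (IH C A) in E.
    - rewrite (ind_iff (PPre eta C == r) (p == r)) in E; [lia|].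
      rewrite EC; reflexivity.
    - apply comp_size in HC; assumption.
    - apply (normal_comp _ _ _ HM HC).
    - apply (normal_comp _ _ _ HM HA).
    - assumption. }
  destruct (match_comp M N IH HM HN HMN _ _ HA) as (B & HB & _).
  destruct (Hstep _ _ HB) as [_ E].
  (* Compare the two residual equations at [eta.C]: as [C] is too small to contain [eta.C], the
     indicator of [eta.B == eta.C] must be positive. *)
  assert (Hsq : forall zeta C, comp N zeta C -> PPre zeta C == PPre eta B).
  { intros zeta C HC; destruct (Hstep _ _ HC) as [-> E'].
    specialize (E (PPre eta C)); specialize (E' (PPre eta C)); simpl in E, E'.
    rewrite (ind_true (PPre eta C == PPre eta C)) in E' by reflexivity.
    rewrite (cnt_small (PPre eta C) C) in E' by (simpl; lia).
    symmetry; apply ind_pos; lia. }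
  destruct (cnt_all_comps (PPre eta B) N Hsq) as [k Hk].
  destruct (cnt_all_comps p M Hall) as [m Hm].
  assert (HAp : cnt p A = 0).
  { apply cnt_small; rewrite <- (eqD_size _ _ EA); simpl; lia. }
  (* If [eta.B] were [p], [E] at [p] would give [cnt p N = cnt p M]. *)
  assert (Hqp : ~ PPre eta B == p).
  { intros Eq; specialize (E p); simpl in E.
    rewrite !ind_true in E by (assumption || reflexivity).
    rewrite (cnt_small p B) in E; [lia|].
    rewrite <- (eqD_size _ _ Eq); simpl; lia. }
  assert (Hk0 : 1 <= k).
  { pose proof (comp_cnt_pos _ _ _ HB); rewrite Hk in H; lia. }
  (* [eta.B] occurs in [N] but not in [M], so maximality of [p] bounds its size. *)
  assert (HBp : cnt p B = 0).
  { apply cnt_small; enough (size (PPre eta B) <= size p) by (simpl in *; lia).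
    apply Hmax; rewrite Hm, Hk, (ind_false (p == _)), ind_true; try lia.
    - reflexivity.
    - intros H; apply Hqp; symmetry; assumption. }
  (* At [p], the equation [E] reads [0 + 0 + 1 = m + 0 + 0]. *)
  assert (m = 1) as ->.
  { specialize (E p); simpl in E; rewrite Hk, Hm, HAp, HBp in E.
    rewrite (ind_true (p == p)) in E by reflexivity.
    rewrite ind_false in E by assumption; lia. }
  (* With [M] reduced to one [p], the copies of [p] cancel in [E]; one of the [k] copies of [eta.B]
     was consumed. *)
  assert (EAB : A == PPar B (ppow (PPre eta B) (k - 1))).
  { apply cnt_inj; intros r; specialize (E r); simpl in *.
    rewrite Hk, Hm in E; rewrite cnt_ppow; simpl.
    destruct k; [lia|]; simpl in *; rewrite Nat.sub_0_r; lia. }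
  destruct (Nat.eq_dec k 1) as [->|Hk1].
  - apply Hqp; rewrite <- EA; simpl in EAB.
    rewrite EAB, eqD_nil; reflexivity.
  - apply (normal_comp _ _ _ HM HA); exists B, (k - 1); split; auto; lia.
Qed.

Lemma normal_bisimilar_cnt P Q :
  normal P -> normal Q -> bisimilar P Q -> forall r, cnt r P = cnt r Q.
Proof.
  remember (size P) as n eqn:Hn; revert P Q Hn.
  induction n as [n IHn] using lt_wf_ind; intros P Q -> HP HQ H r.
  apply NNPP; intros Hr.
  assert (HQP : bisimilar Q P) by (symmetry; assumption).
  assert (Hs := bisimilar_size _ _ H).
  (* Any [p] with differing counts occurs in [P] or [Q], so the common size bounds its size. *)
  destruct (exists_max (fun s => exists p, size p = s /\ cnt p P <> cnt p Q)
    (size P)) as (s & (p & <- & Hp) & Hmax).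
  { eauto. }
  { intros s (p & <- & Hp); pose proof (cnt_size p P); pose proof (cnt_size p Q).
    lia. }
  destruct (Nat.lt_total (cnt p P) (cnt p Q)) as [Hlt|[Heq|Hlt]].
  (* The choice of [p] is symmetric in [P] and [Q], so their roles may be exchanged. *)
  - apply (normal_unequal_absurd Q P p); auto.
    + intros X Y HX; rewrite <- Hs in HX; eauto.
    + intros q Hq; apply Hmax; exists q; auto.
  - auto.
  - apply (normal_unequal_absurd P Q p); auto.
    + intros X Y HX; eauto.
    + intros q Hq; apply Hmax; exists q; auto.
Qed.

Lemma bisimilar_eqD P Q : bisimilar P Q -> P == Q.
Proof.
  intros H; destruct (normal_form P) as (P' & EP & HP).
  destruct (normal_form Q) as (Q' & EQ & HQ).
  rewrite EP, EQ; apply cnt_inj, normal_bisimilar_cnt; auto.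
  rewrite <- (eqD_sound _ _ EP), <- (eqD_sound _ _ EQ); assumption.
Qed.

End NormalForms.

(** * Elimination of variables by fresh prefixes *)

Section Variables.

Context {name : Type}.
Implicit Types (M N : term name) (a : name).

Notation "M == N" := (derivable (@D name) M N) (at level 70).

Fixpoint bounded (n : nat) M : Prop :=
  match M with
  | Nil _ => True
  | Pre _ M => bounded n M
  | Par M N => bounded n M /\ bounded n N
  | Var _ x => x < n
  end.

Lemma bounded_le n m M : n <= m -> bounded n M -> bounded m M.
Proof. intros Hnm; induction M; simpl; intuition lia. Qed.

Lemma exists_bound M : exists n, bounded n M.
Proof.
  induction M as [|eta M [n IH]|M [n IHM] N [m IHN]|x]; simpl.
  - exists 0; exact I.
  - exists n; auto.
  - exists (n + m); split; [apply (bounded_le n)|apply (bounded_le m)]; auto; lia.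
  - exists (S x); lia.
Qed.

Lemma emb_inst_closed rho M : bounded 0 M -> emb (inst rho M) = M.
Proof.
  induction M; simpl; intros H; auto.
  - rewrite IHM; auto.
  - rewrite IHM1, IHM2; tauto.
  - lia.
Qed.

Fixpoint names M : list name :=
  match M with
  | Nil _ | Var _ _ => nil
  | Pre (Inp a) M | Pre (Out a) M => a :: names M
  | Par M N => names M ++ names N
  end.

Definition var_to_prefix (n : nat) a (x : nat) : term name :=
  if x =? n then Pre (Inp a) (Nil name) else Var name x.

(* Every input on [a] becomes [X_n | -], not only those followed by [0]: this
   keeps the axioms (D_i) valid, which move processes below the prefix. *)
Fixpoint prefix_to_var (n : nat) a M : term name :=
  match M with
  | Nil _ => Nil name
  | Var _ x => Var name x
  | Par M N => Par (prefix_to_var n a M) (prefix_to_var n a N)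
  | Pre eta M =>
      if excluded_middle_informative (eta = Inp a)
      then Par (Var name n) (prefix_to_var n a M)
      else Pre eta (prefix_to_var n a M)
  end.

Lemma prefix_to_var_pow n a M k :
  prefix_to_var n a (pow M k) = pow (prefix_to_var n a M) k.
Proof.
  induction k as [|[|k] IH]; auto; simpl in *; rewrite IH; reflexivity.
Qed.

(** Reading back does not commute with substitution, so the induction carries an arbitrary [sigma]
    applied first; a substitution step then composes with it. *)
Lemma prefix_to_var_subst n a sigma M N :
  M == N ->
  prefix_to_var n a (subst sigma M) == prefix_to_var n a (subst sigma N).
Proof.
  intros H; revert sigma; induction H
    as [M N H| |M N _ IH|M N L _ IH1 _ IH2|eta M N _ IH|M M' N N' _ IH1 _ IH2
       |tau M N _ IH]; intros sigma; simpl.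
  - destruct H; simpl; auto using Par_comm, Par_assoc, Par_nil.
    rewrite !subst_pow, !prefix_to_var_pow, Nat.add_1_r.
    cbn [subst prefix_to_var].
    (* If [eta] is the input on [a], both sides of (D_i) become powers of [X | M] up to
       associativity; otherwise (D_i) itself is used. *)
    destruct excluded_middle_informative.
    + rewrite pow_S, Par_assoc; reflexivity.
    + apply Pre_distr; assumption.
  - reflexivity.
  - symmetry; auto.
  - rewrite (IH1 sigma); auto.
  - destruct excluded_middle_informative; rewrite (IH sigma); reflexivity.
  - rewrite (IH1 sigma), (IH2 sigma); reflexivity.
  - rewrite !subst_subst; apply IH.
Qed.

(** By freshness only the inserted prefixes are read back, each as [X | 0]. *)
Lemma prefix_to_var_to_prefix n a M :
  ~ In a (names M) -> prefix_to_var n a (subst (var_to_prefix n a) M) == M.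
Proof.
  induction M as [|eta M IH|M IHM N IHN|x]; simpl; intros Ha.
  - reflexivity.
  - destruct excluded_middle_informative as [->|_].
    + exfalso; apply Ha; left; reflexivity.
    + rewrite IH; [reflexivity|]; intros H; apply Ha.
      destruct eta; right; assumption.
  - rewrite in_app_iff in Ha; rewrite IHM, IHN by tauto; reflexivity.
  - unfold var_to_prefix; destruct (Nat.eqb_spec x n) as [->|]; simpl.
    + destruct excluded_middle_informative as [_|[]]; auto; apply Par_nil.
    + reflexivity.
Qed.

Lemma bounded_var_to_prefix n a M :
  bounded (S n) M -> bounded n (subst (var_to_prefix n a) M).
Proof.
  induction M; simpl; auto; [tauto|].
  unfold var_to_prefix; destruct (Nat.eqb_spec x n); simpl; lia.
Qed.

Lemma ext_equal_derivable (name_infinite : ~ Finite name) n M N :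
  bounded n M -> bounded n N -> ext_equal M N -> M == N.
Proof.
  revert M N; induction n as [|n IH]; intros M N HM HN H.
  (* Without variables any [rho] will do; this is completeness for closed processes. *)
  - pose (rho := fun _ : nat => PNil name).
    rewrite <- (emb_inst_closed rho M), <- (emb_inst_closed rho N) by assumption.
    apply bisimilar_eqD, H.
  - assert (exists a, ~ In a (names M ++ names N)) as [a Ha].
    { apply not_all_ex_not; intros Hall; apply name_infinite.
      exists (names M ++ names N); exact Hall. }
    rewrite in_app_iff in Ha.
    rewrite <- (prefix_to_var_to_prefix n a M), <- (prefix_to_var_to_prefix n a N)
      by tauto.
    (* The identity substitution gives the goal the shape required by [prefix_to_var_subst]. *)
    rewrite <- (subst_Var (subst _ M)), <- (subst_Var (subst _ N)).
    apply prefix_to_var_subst, IH; auto using bounded_var_to_prefix.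
    intros rho; rewrite !inst_subst; apply H.
Qed.

End Variables.

Theorem theorem3p6 (name : Type) (name_infinite : ~ Finite name)
  (M N : term name) :
  ext_equal M N <-> derivable (@D name) M N.
Proof.
  split; [|apply derivable_sound].
  destruct (exists_bound M) as [m HM], (exists_bound N) as [n HN].
  apply (ext_equal_derivable name_infinite (m + n)).
  - apply (bounded_le m); auto; lia.
  - apply (bounded_le n); auto; lia.
Qed.
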